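(* Let $m$ be a positive integer and $\phi = \frac{1+\sqrt5}{2}$. The number of P-positions of $m$-Modular Wythoff's Game is finite; in particular, it is equal to $2\lfloor m/\phi \rfloor + 1$.
   Context: $m$-Modular Wythoff's Game ($m$ a positive integer): a position is an ordered pair $(p_1,p_2)$ of nonnegative integers, the numbers of tokens in two piles. Two players alternate moves. The allowed moves are: (Type I) take any positive number of tokens from exactly one pile; (Type II) take a positive number $k_1$ of tokens from the first pile and a positive number $k_2$ of tokens from the second pile, provided $k_1 \equiv k_2 \pmod m$. (Pile sizes must remain nonnegative.) The player who cannot move, i.e. whose turn it is at $(0,0)$, loses. A P-position is a position from which the previous player (the one who just moved) has a winning strategy; an N-position is one from which the next player to move has a winning strategy. Equivalently, since the game always terminates: a position is a P-position if and only if every move from it leads to an N-position, and a position is an N-position if and only if some move from it leads to a P-position. Positions are ordered pairs, so $(p_1,p_2)$ and $(p_2,p_1)$ are counted separately when $p_1\neq p_2$. *)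

(* Defs.v *)
From HB Require Import structures.
From mathcomp Require Import all_boot all_order all_algebra.
From mathcomp Require Import all_classical all_reals.

Set Implicit Arguments.
Unset Strict Implicit.
Unset Printing Implicit Defensive.

Import Order.TTheory GRing.Theory Num.Theory.

(* Normal-play outcome classes of an impartial game given by its move relation.
   Taking the least fixed point means that the derivations are exactly the
   winning strategies, each of which wins in finitely many moves. *)
Section Outcome.
Variables (T : Type) (move : T -> T -> Prop).

Inductive P_position (p : T) : Prop :=
| P_position_intro of (forall q, move p q -> N_position q)
with N_position (p : T) : Prop :=
| N_position_intro q of move p q & P_position q.

End Outcome.

Inductive wythoff_move (m : nat) : nat * nat -> nat * nat -> Prop :=
| take_first p1 p2 k of (0 < k <= p1)%N :
    wythoff_move m (p1, p2) (p1 - k, p2)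
| take_second p1 p2 k of (0 < k <= p2)%N :
    wythoff_move m (p1, p2) (p1, p2 - k)
| take_both p1 p2 k1 k2 of
    (0 < k1 <= p1)%N & (0 < k2 <= p2)%N & k1 = k2 %[mod m] :
    wythoff_move m (p1, p2) (p1 - k1, p2 - k2).

Definition wythoff_P_positions (m : nat) : set (nat * nat) :=
  [set p | P_position (wythoff_move m) p]%classic.

Definition golden_ratio (R : realType) : R := ((1 + Num.sqrt 5%:R) / 2%:R)%R.

(* Main.v *)
Require Import Defs.
From HB Require Import structures.
From mathcomp Require Import all_boot all_order all_algebra.
From mathcomp Require Import finmap.
From mathcomp Require Import all_classical all_reals.
From mathcomp Require Import zify ring lra.

Set Implicit Arguments.
Unset Strict Implicit.
Unset Printing Implicit Defensive.

Import Order.TTheory GRing.Theory Num.Theory.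
Local Open Scope classical_set_scope.
Local Open Scope fset_scope.
Local Open Scope ring_scope.

(** Let [a n = floor (n phi)], [b n = a n + n] and [N = floor (m / phi)].  The
    P-positions are the classical Wythoff pairs [(a n, b n)] and [(b n, a n)]
    with [n <= N].  The cut-off comes from the residues mod [m] of the
    differences: the pairs [(a n, b n)] and [(b k, a k)] have congruent
    differences exactly when [n + k] is [0] or [m], and for [n + k = m] one has
    [a n <= b k] iff [n phi <= m]; so no move joins them as long as [n <= N],
    whereas a position beyond all these pairs whose difference has residue
    [d > N] can reach [(b k, a k)] with [k = m - d]. *)

(** * Kernels of terminating games *)

Section Kernel.
Variables (T : Type) (move : T -> T -> Prop) (rank : T -> nat).
Hypothesis move_rank : forall p q, move p q -> (rank q < rank p)%N.

Lemma P_not_N_position p : P_position move p -> ~ N_position move p.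
Proof.
have [n] := ubnP (rank p); elim: n p => // n IH p le_pn [Pp] [q pq Pq].
apply: (IH q) => //; last exact: Pp.
exact: leq_trans (move_rank pq) _.
Qed.

(** One induction on [rank] settles both sides: stability sends every move from [S] to an
    N-position, and absorption gives each position outside [S] a move to a P-position. *)
Lemma P_position_kernel (S : T -> Prop) :
    (forall p q, S p -> move p q -> ~ S q) ->
    (forall p, ~ S p -> exists2 q, move p q & S q) ->
  forall p, P_position move p <-> S p.
Proof.
move=> stable absorbing.
have SPN p : (S p -> P_position move p) /\ (~ S p -> N_position move p).
  have [n] := ubnP (rank p); elim: n p => // n IH p le_pn; split=> [Sp|nSp].
    constructor=> q pq; apply: (IH q _).2; last exact: stable pq.
    exact: leq_trans (move_rank pq) _.
  have [q pq Sq] := absorbing p nSp; apply: (N_position_intro pq).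
  by apply: (IH q _).1 => //; exact: leq_trans (move_rank pq) _.
move=> p; split=> [Pp|]; last exact: (SPN p).1.
by apply: contrapT => /(SPN p).2; exact: P_not_N_position.
Qed.

End Kernel.

Lemma wythoff_move_rank m p q :
  wythoff_move m p q -> (q.1 + q.2 < p.1 + p.2)%N.
Proof. by case=> /= *; lia. Qed.

(** * Wythoff pairs cut off at [N], for an abstract sequence [a] *)

Section WythoffPairs.
Local Open Scope nat_scope.
Variables (m N : nat) (a : nat -> nat).
Local Notation b n := (a n + n).
Hypothesis a0 : a 0 = 0.
Hypothesis a_incr : forall i j, i < j -> a i < a j.
Hypothesis a_b_cover : forall p, 0 < p -> exists n, p = a n \/ p = b n.
Hypothesis a_b_disjoint : forall n k, 0 < n -> a n <> b k.
Hypothesis low : forall n k, n + k = m -> n <= N -> a n <= b k.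
Hypothesis high : forall n k, n + k = m -> N < n -> b k <= a n.

Definition wythoff_pairs (p : nat * nat) : Prop :=
  exists2 n, n <= N & p = (a n, b n) \/ p = (b n, a n).

Let a_mono i j : i <= j -> a i <= a j.
Proof. by rewrite leq_eqVlt => /orP[/eqP->//|/a_incr/ltnW]. Qed.

Let a_lt i j : a i < a j -> i < j.
Proof. by case: (ltnP i j) => // /a_mono; lia. Qed.

Let a_inj i j : a i = a j -> i = j.
Proof. by case: (ltngtP i j) => // /a_incr; lia. Qed.

Let b_inj i j : b i = b j -> i = j.
Proof. by case: (ltngtP i j) => // ij; have := a_incr ij; lia. Qed.

Let a_b_eq n k : a n = b k -> n = 0 /\ k = 0.
Proof.
case: n => [|n] e; last by case: (a_b_disjoint (ltn0Sn n) e).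
by rewrite a0 in e; split=> //; lia.
Qed.

Hypothesis m_gt0 : 0 < m.

Let low_lt n k : n + k = m -> n <= N -> a n < b k.
Proof.
move=> nk nN; have := low nk nN; rewrite leq_eqVlt => /orP[/eqP/a_b_eq|//].
lia.
Qed.

(** Otherwise [low_lt] with [n = m] and [k = 0] would give [a m < 0]. *)
Let N_lt_m : N < m.
Proof.
rewrite ltnNge; apply/negP => le_mN.
by have := low_lt (addn0 m) le_mN; rewrite a0.
Qed.

Lemma wythoff_pairsC p q : wythoff_pairs (p, q) -> wythoff_pairs (q, p).
Proof. by case=> n nN [] [-> ->]; exists n => //; [right|left]. Qed.

Lemma wythoff_moveC p q p' q' :
  wythoff_move m (p, q) (p', q') -> wythoff_move m (q, p) (q', p').
Proof.
move=> mv; inversion mv; subst.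
- exact: take_second.
- exact: take_first.
- exact: take_both.
Qed.

Let stable_sorted n q :
  n <= N -> wythoff_move m (a n, b n) q -> ~ wythoff_pairs q.
Proof.
move=> nN mv; inversion mv as [p1 p2 k ltk|p1 p2 k ltk|p1 p2 k1 k2 lt1 lt2 eqk];
  subst; case=> j jN [] [e1 e2].
- by have /b_inj nj : b n = b j by []; subst; lia.
- have /esym/a_b_eq : b n = a j by [].
  lia.
- by have /a_inj nj := e1; subst; lia.
- by have /a_b_eq := e1; lia.
(* Same orientation: the differences [n] and [j] are congruent and below [m], hence equal, so no
   token was taken. *)
- have eqn : (n + k1 = j + k1 %[mod m]).
    have -> : n + k1 = k2 + j by lia.
    by rewrite -modnDml -eqk modnDml addnC.
  move/eqP: eqn; rewrite eqn_modDr !modn_small; try lia.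
  by move/eqP=> nj; subst; lia.
(* Opposite orientation: [m] divides [n + j], which is below [2 * m]. The value [0] leaves no token
   to take, and for [m] the bound [low_lt] contradicts [b j < a n]. *)
- have eqn : (n + j + k1 = 0 + k1 %[mod m]).
    have -> : n + j + k1 = k2 by lia.
    by rewrite add0n.
  move/eqP: eqn; rewrite eqn_modDr mod0n => /dvdnP[[|[|c]] eqm].
  + have n0 : n = 0 by lia.
    by subst; lia.
  + by have := @low_lt n j; lia.
  + by lia.
Qed.

Lemma wythoff_pairs_stable p q :
  wythoff_pairs p -> wythoff_move m p q -> ~ wythoff_pairs q.
Proof.
case: q => q1 q2; case=> n nN [] ->; first exact: stable_sorted.
move/wythoff_moveC=> mv /wythoff_pairsC; exact: stable_sorted mv.
Qed.

(** Writing the congruence with sums keeps truncated subtraction out of it. *)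
Let move_both p1 p2 q1 q2 : q1 < p1 -> q2 < p2 ->
  p1 + q2 = p2 + q1 %[mod m] -> wythoff_move m (p1, p2) (q1, q2).
Proof.
move=> lt1 lt2 e.
have -> : q1 = p1 - (p1 - q1) by lia.
have -> : q2 = p2 - (p2 - q2) by lia.
apply: take_both; try lia.
apply/eqP; rewrite -(eqn_modDr (q1 + q2)).
have -> : p1 - q1 + (q1 + q2) = p1 + q2 by lia.
have -> : p2 - q2 + (q1 + q2) = p2 + q1 by lia.
exact/eqP.
Qed.

Let move_first p1 p2 q1 : q1 < p1 -> wythoff_move m (p1, p2) (q1, p2).
Proof.
move=> lt1; have -> : q1 = p1 - (p1 - q1) by lia.
by apply: take_first; lia.
Qed.

Let move_second p1 p2 q2 : q2 < p2 -> wythoff_move m (p1, p2) (p1, q2).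
Proof.
move=> lt2; have -> : q2 = p2 - (p2 - q2) by lia.
by apply: take_second; lia.
Qed.

Let absorbing_sorted p1 p2 : p1 <= p2 -> ~ wythoff_pairs (p1, p2) ->
  exists2 q, wythoff_move m (p1, p2) q & wythoff_pairs q.
Proof.
move=> le12 nS.
have [[n nN eb]|nb1] := pselect (exists2 n, n <= N & p1 = b n).
  exists (p1, a n); last by exists n => //; right; rewrite eb.
  apply: move_second; rewrite ltn_neqAle; apply/andP; split; last by lia.
  by apply/eqP => e; apply: nS; exists n => //; right; rewrite -e eb.
have [[n nN ea]|na1] := pselect (exists2 n, n <= N & p1 = a n).
  subst p1; case: (ltngtP p2 (b n)) => [ltb|gtb|eb].
  (* As in the classical game, move to the pair with the same difference [p2 - a n]; its index is
     below [n]. *)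
  - have dn : p2 - a n < n by lia.
    have := a_incr dn => lta.
    exists (a (p2 - a n), b (p2 - a n)).
      by apply: move_both; try lia; congr (_ %% _); lia.
    by exists (p2 - a n); [lia|left].
  - exists (a n, b n); last by exists n => //; left.
    exact: move_second.
  - by case: nS; exists n => //; left; rewrite eb.
have p1_gt0 : 0 < p1.
  by rewrite lt0n; apply/eqP => p10; apply: na1; exists 0; rewrite ?a0.
(* Covering gives [p1] an index, which must exceed [N]. *)
have p1_ge : a N.+1 <= p1.
  rewrite leqNgt; apply/negP => p1lt.
  have [n [e|e]] := a_b_cover p1_gt0.
    by apply: na1; exists n => //; rewrite -ltnS; apply: a_lt; lia.
  by apply: nb1; exists n => //; rewrite -ltnS; apply: a_lt; lia.
have aN : a N < a N.+1 by exact: a_incr.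
have [c [d dm ep2]] : exists c, exists2 d, d < m & p2 = c * m + d + p1.
  exists ((p2 - p1) %/ m), ((p2 - p1) %% m); first by rewrite ltn_mod.
  by rewrite -divn_eq subnK.
have [dN|dN] := leqP d N.
  have := a_mono dN => ad.
  exists (a d, b d); last by exists d => //; left.
  apply: move_both; try lia.
  have -> : p2 + a d = c * m + (p1 + b d) by lia.
  by rewrite modnMDl.
(* By monotonicity it is enough to apply [high] at the first index past the cut-off. *)
have bk : b (m - d) <= a N.+1.
  have := @high N.+1 (m - N.+1); have := @a_mono (m - d) (m - N.+1); lia.
(* If [d] and [m - d] both exceeded [N], adding the two instances of [high] would give [m <= 0]. *)
have kN : m - d <= N.
  rewrite leqNgt; apply/negP => Nk.
  have := @high d (m - d); have := @high (m - d) d; lia.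
have neb : p1 <> b (m - d) by move=> e; apply: nb1; exists (m - d).
exists (b (m - d), a (m - d)); last by exists (m - d) => //; right.
apply: move_both; try lia.
have -> : p2 + b (m - d) = c.+1 * m + (p1 + a (m - d)) by lia.
by rewrite modnMDl.
Qed.

Lemma wythoff_pairs_absorbing p : ~ wythoff_pairs p ->
  exists2 q, wythoff_move m p q & wythoff_pairs q.
Proof.
case: p => p1 p2 nS; have [le12|/ltnW le21] := leqP p1 p2.
  exact: absorbing_sorted.
have [|[q1 q2] mv Sq] := absorbing_sorted le21.
  by move/wythoff_pairsC.
by exists (q2, q1); [exact: wythoff_moveC|exact: wythoff_pairsC].
Qed.

Lemma wythoff_P_positionsE : wythoff_P_positions m = [set p | wythoff_pairs p].
Proof.
apply/seteqP; split=> p;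
  by have [] := P_position_kernel (@wythoff_move_rank m)
    wythoff_pairs_stable wythoff_pairs_absorbing p.
Qed.

(** The second list starts at [1] because index [0] gives [(0, 0)] in both orientations; hence the
    odd count. *)
Definition wythoff_seq : seq (nat * nat) :=
  [seq (a n, b n) | n <- iota 0 N.+1] ++ [seq (b n, a n) | n <- iota 1 N].

Lemma mem_wythoff_seq p : p \in wythoff_seq <-> wythoff_pairs p.
Proof.
rewrite mem_cat; split.
  by case/orP => /mapP[n]; rewrite mem_iota => nN ->; exists n; (lia || tauto).
case=> n nN [->|->]; first by rewrite (map_f (fun n => (a n, b n))) ?mem_iota.
case: n nN => [|n] nN; first by rewrite !addn0 /= inE addn0 eqxx.
by rewrite (map_f (fun n => (b n, a n))) ?orbT // mem_iota; lia.
Qed.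

Lemma uniq_wythoff_seq : uniq wythoff_seq.
Proof.
rewrite cat_uniq !map_inj_uniq ?iota_uniq => [|i j [] /b_inj//|i j [] /a_inj//].
rewrite andbT; apply/hasPn => q /mapP[n]; rewrite mem_iota => nN ->.
by apply/negP => /mapP[k _ [/esym/a_b_eq]]; lia.
Qed.

Lemma card_wythoff_P_positions :
  finite_set (wythoff_P_positions m) /\
  #|` fset_set (wythoff_P_positions m)|%fset = N.*2.+1.
Proof.
have E : wythoff_P_positions m = [set` wythoff_seq].
  rewrite wythoff_P_positionsE; apply/seteqP.
  by split=> p /mem_wythoff_seq.
have fin : finite_set (wythoff_P_positions m).
  by apply/finite_seqP; exists wythoff_seq.
split=> //.
have -> : fset_set (wythoff_P_positions m) = [fset p in wythoff_seq]%fset.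
  by apply/fsetP => p; rewrite in_fset_set // E in_fset mem_setE.
rewrite card_fseq undup_id ?uniq_wythoff_seq // size_cat !size_map !size_iota.
by lia.
Qed.

End WythoffPairs.

(** * Irrationality of the golden ratio, in integer form *)

Lemma golden_nat_eq n p : (p * p = n * n + n * p)%N -> n = 0%N.
Proof.
have [k] := ubnP n; elim: k n p => // k IH n p nk e.
case: (posnP n) => // n0; have r : (p - n = 0)%N.
  (* Descent: [(p - n, n)] solves the same equation. *)
  by apply: (IH (p - n)%N n); nia.
nia.
Qed.

(** * Beatty sequences of [phi] and [phi ^ 2] *)

Section Beatty.
Variable R : realType.
Local Notation phi := (golden_ratio R).

Lemma golden_sqr : phi * phi = phi + 1.
Proof.
have := @sqr_sqrtr R 5%:R (ler0n _ _).
by rewrite /golden_ratio expr2; set s := Num.sqrt _ => e; lra.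
Qed.

Lemma golden_gt1 : 1 < phi.
Proof.
have : 1 < Num.sqrt (5%:R : R) by rewrite -[ltLHS]sqrtr1 ltr_sqrt ?ltr0n // ltr1n.
by rewrite /golden_ratio; set s := Num.sqrt _ => e; lra.
Qed.

Let phi_gt0 : 0 < phi. Proof. by have := golden_gt1; lra. Qed.

Lemma golden_irrational n p : n%:R * phi = p%:R :> R -> n = 0%N.
Proof.
move=> e; apply: (@golden_nat_eq n p); apply/eqP; rewrite -(eqr_nat R).
rewrite natrD !natrM -e; apply/eqP.
have := golden_sqr; move: phi => f ff.
have -> : n%:R * f * (n%:R * f) = n%:R * n%:R * (f * f) :> R by ring.
by rewrite ff; ring.
Qed.

Definition lower_wythoff (n : nat) : nat := Num.trunc (n%:R * phi).
Local Notation a := lower_wythoff.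

Lemma lower_wythoff_itv n : (a n)%:R <= n%:R * phi < (a n)%:R + 1.
Proof.
rewrite -[1]/(1%:R) -natrD addn1; apply: truncn_itv.
by rewrite mulr_ge0 // ltW.
Qed.

Lemma lower_wythoff_unique n p :
  p%:R <= n%:R * phi < p%:R + 1 -> a n = p.
Proof.
have /andP[l1 u1] := lower_wythoff_itv n => /andP[l2 u2].
have : (a n < p.+1)%N by rewrite -(ltr_nat R) -natr1; lra.
have : (p < (a n).+1)%N by rewrite -(ltr_nat R) -natr1; lra.
lia.
Qed.

Lemma lower_wythoff0 : a 0 = 0%N.
Proof. by apply: lower_wythoff_unique; rewrite mul0r; apply/andP; split; lra. Qed.

Lemma lower_wythoff_incr i j : (i < j)%N -> (a i < a j)%N.
Proof.
move=> ij; have /andP[l1 u1] := lower_wythoff_itv i.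
have /andP[l2 u2] := lower_wythoff_itv j.
have : i%:R + 1 <= j%:R :> R by rewrite natr1 ler_nat.
have g1 := golden_gt1 => ij1.
have : (i%:R + 1) * phi <= j%:R * phi by rewrite ler_wpM2r // ltW.
rewrite mulrDl mul1r => h.
have : (a i)%:R < (a j)%:R + 0 :> R by lra.
by rewrite addr0 ltr_nat.
Qed.

Lemma lower_upper_wythoff_cover p :
  (0 < p)%N -> exists n, p = a n \/ p = (a n + n)%N.
Proof.
move=> p_gt0; have p1 : 1 <= p%:R :> R by rewrite ler1n.
have x_ge0 : 0 <= (p%:R + 1) / phi by rewrite divr_ge0 ?ltW //; lra.
have := truncn_itv x_ge0; set n := Num.trunc _.
rewrite -natr1 ler_pdivlMr // ltr_pdivrMr // => /andP[ln un].
(* Equality would force [n = 0] by irrationality, hence [p + 1 < phi], whereas [phi < 2]. *)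
have n_p : n%:R * phi != p%:R + 1.
  apply/eqP; rewrite natr1 => /golden_irrational n0.
  move: un; rewrite n0 add0r mul1r => un.
  have := golden_sqr; have := golden_gt1; nra.
have {}ln : n%:R * phi < p%:R + 1 by rewrite lt_neqAle n_p.
(* Beatty: [n] is the largest index with [n phi < p + 1]. *)
have [le_p|lt_p] := lerP p%:R (n%:R * phi).
  by exists n; left; apply/esym/lower_wythoff_unique; rewrite le_p ln.
have np : (n < p)%N.
  rewrite -(ltr_nat R); have := golden_gt1.
  have : 0 <= n%:R :> R by [].
  by nra.
(* Here [n phi < p] and [p + 1 < (n + 1) phi]. By [phi ^ 2 = phi + 1] these amount to
   [n < (p - n) phi < n + 1]. *)
exists (p - n)%N; right.
suff -> : a (p - n) = n by lia.
apply: lower_wythoff_unique; rewrite natrB ?(ltnW np) //.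
have := golden_sqr; have := golden_gt1 => g1 gg.
apply/andP; split; nra.
Qed.

Lemma lower_upper_wythoff_disjoint n k : (0 < n)%N -> a n <> (a k + k)%N.
Proof.
move=> n_gt0 e.
have /andP[l1 u1] := lower_wythoff_itv n.
have /andP[l2 u2] := lower_wythoff_itv k.
(* Irrationality makes the bound strict, as [lt1] below requires. *)
have l1s : (a n)%:R < n%:R * phi.
  rewrite lt_neqAle l1 andbT; apply/eqP => /esym/golden_irrational n0.
  by rewrite n0 in n_gt0.
have eR : (a n)%:R = (a k)%:R + k%:R :> R by rewrite e natrD.
have gg := golden_sqr; have g1 := golden_gt1.
(* Beatty: [1 / phi + 1 / phi ^ 2 = 1] squeezes [n + k] strictly between [a n]
   and [a n + 1]. *)
have f1 : 0 < phi - 1 by lra.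
have kE : (k%:R * phi + k%:R) * (phi - 1) = k%:R * phi.
  have -> : (k%:R * phi + k%:R) * (phi - 1) = k%:R * (phi * phi - 1) by ring.
  by rewrite gg addrK.
have lt1 : (a n < n + k)%N.
  rewrite -(ltr_nat R) natrD -(ltr_pM2r phi_gt0).
  suff : (a n)%:R * (phi - 1) <= k%:R * phi by lra.
  by rewrite -kE ler_pM2r //; lra.
have lt2 : (n + k < (a n).+1)%N.
  rewrite -(ltr_nat R) natrD -natr1 -(ltr_pM2r phi_gt0).
  suff : k%:R * phi < ((a n)%:R + 1) * (phi - 1) by lra.
  by rewrite -kE ltr_pM2r //; lra.
lia.
Qed.

(** Multiplying the hypothesis by [phi] gives [n <= k phi], so [n phi <= n + k <= k phi + k]; then
    take floors. The next lemma reverses these inequalities. *)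
Lemma lower_wythoff_le_upper n k :
  n%:R * phi <= (n + k)%:R -> (a n <= a k + k)%N.
Proof.
rewrite natrD => h.
have /andP[l1 u1] := lower_wythoff_itv n.
have /andP[l2 u2] := lower_wythoff_itv k.
have gg := golden_sqr; have g1 := golden_gt1.
rewrite -ltnS -(ltr_nat R) -natr1 natrD.
suff : n%:R * phi <= k%:R * phi + k%:R by lra.
have : n%:R * phi * phi <= (n%:R + k%:R) * phi by rewrite ler_pM2r.
by rewrite -mulrA gg; lra.
Qed.

Lemma upper_wythoff_le_lower n k :
  (n + k)%:R <= n%:R * phi -> (a k + k <= a n)%N.
Proof.
rewrite natrD => h.
have /andP[l1 u1] := lower_wythoff_itv n.
have /andP[l2 u2] := lower_wythoff_itv k.
have gg := golden_sqr; have g1 := golden_gt1.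
rewrite -ltnS -(ltr_nat R) -natr1 natrD.
suff : k%:R * phi + k%:R <= n%:R * phi by lra.
have : (n%:R + k%:R) * phi <= n%:R * phi * phi by rewrite ler_pM2r.
by rewrite -mulrA gg; lra.
Qed.

End Beatty.

(** * The count for the cut-off [floor (m / phi)] *)

Theorem corollary6 (R : realType) (m : nat) (m_gt0 : (0 < m)%N) :
  finite_set (wythoff_P_positions m) /\
  (#|` fset_set (wythoff_P_positions m)|%fset : int) =
    2 * Num.floor (m%:R / golden_ratio R) + 1.
Proof.
have phi_gt0 : 0 < golden_ratio R := lt_trans ltr01 (golden_gt1 R).
have x_ge0 : 0 <= m%:R / golden_ratio R by rewrite divr_ge0 // ltW.
set x := m%:R / golden_ratio R in x_ge0 *.
have /andP[Nx xN] := truncn_itv x_ge0.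
have -> : Num.floor x = Num.trunc x.
  by rewrite truncn_floor x_ge0 gez0_abs // floor_ge0.
have [||fin ->] := @card_wythoff_P_positions m (Num.trunc x) _
  (lower_wythoff0 R) (@lower_wythoff_incr R) (@lower_upper_wythoff_cover R)
  (@lower_upper_wythoff_disjoint R) _ _ m_gt0; last by split=> //; lia.
(* As [n + k = m], the two comparison lemmas ask only on which side of [m / phi] the index [n]
   lies. *)
- move=> n k nk nN; apply: lower_wythoff_le_upper; rewrite nk -ler_pdivlMr //.
  by apply: le_trans Nx; rewrite ler_nat.
- move=> n k nk nN; apply: upper_wythoff_le_lower; rewrite nk -ler_pdivrMr //.
  by apply: le_trans (ltW xN) _; rewrite ler_nat.
Qed.
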